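(* There is no constant $C$ such that $\kappa(\Omega)\le C\,\kappa(\Omega^* )$ holds for all balanced, not necessarily connected, one-dimensional domains $\Omega\subset\mathbb{R}$.
   Context: A one-dimensional domain here is a nonempty bounded open subset of $\mathbb{R}$, not necessarily connected. $\Omega$ is balanced if it is invariant under $x\mapsto-x$. Let $\widehat{\chi_\Omega}(\xi)=\int_\Omega e^{i\xi x}\,dx$, and let $\mathcal{N}(\Omega)=\{\xi\in\mathbb{R}:\widehat{\chi_\Omega}(\xi)=0\}$. Set $\kappa(\Omega)=\min\{|\xi|:\xi\in\mathcal{N}(\Omega)\}$, with $\kappa(\Omega)=\infty$ if $\mathcal{N}(\Omega)=\emptyset$. $\Omega^*$ is the open interval centred at $0$ of the same length (Lebesgue measure) as $\Omega$. *)

(* Defs.v *)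
From HB Require Import structures.
From mathcomp Require Import all_boot all_order all_algebra.
From mathcomp Require Import complex.
From mathcomp Require Import all_classical all_reals all_analysis.
From mathcomp Require Import measurable_realfun lebesgue_integral_under.

Set Implicit Arguments.
Unset Strict Implicit.
Unset Printing Implicit Defensive.

Import Order.TTheory GRing.Theory Num.Theory.
Import numFieldNormedType.Exports.

Local Open Scope classical_set_scope.
Local Open Scope ring_scope.
Local Open Scope complex_scope.

Definition domain1d (R : realType) (Omega : set R) : Prop :=
  [/\ Omega !=set0, bounded_set Omega & open Omega].

Definition balanced (R : realType) (Omega : set R) : Prop :=
  [set - x | x in Omega] = Omega.

(* [expi t] is e^{it}; MathComp-Analysis has no complex exponential. *)
Definition expi (R : realType) (t : R) : R[i] := cos t +i* sin t.

(* Lebesgue integral of a complex-valued function, taken componentwise. *)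
Definition cintegral (R : realType) (D : set R) (f : R -> R[i]) : R[i] :=
  (\int[lebesgue_measure]_(x in D) complex.Re (f x))%R +i*
  (\int[lebesgue_measure]_(x in D) complex.Im (f x))%R.

Definition fourier_indic (R : realType) (Omega : set R) (xi : R) : R[i] :=
  cintegral Omega (fun x => expi (xi * x)).

Definition fourier_zeros (R : realType) (Omega : set R) : set R :=
  [set xi | fourier_indic Omega xi = 0].

(* For a domain the infimum is a minimum whenever there are zeros: see
   [kappa_attained] and [kappa_no_zeros]. *)
Definition kappa (R : realType) (Omega : set R) : \bar R :=
  ereal_inf [set `|xi|%:E | xi in fourier_zeros Omega].

(* [fine] is harmless: a bounded set has finite measure. *)
Definition centred_itv (R : realType) (Omega : set R) : set R :=
  let l := fine (lebesgue_measure Omega) in `](- (l / 2)), (l / 2)[.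

Lemma domain1d_finite_measure (R : realType) (Omega : set R) :
  domain1d Omega -> (lebesgue_measure Omega < +oo)%E.
Proof.
case=> _ [M [_ bM]] oO.
have sub : Omega `<=` `[- (M + 1), M + 1].
  move=> x Ox; rewrite /= in_itv/= -ler_norml.
  by apply: (bM (M + 1)) => //; rewrite ltrDl.
have : (lebesgue_measure Omega <= lebesgue_measure `[(- (M + 1))%R, (M + 1)%R])%E.
  by apply: le_measure => //; rewrite inE; [exact: open_measurable|exact: measurable_itv].
move=> /le_lt_trans; apply.
by rewrite lebesgue_measure_itv/=; case: ifP => _; rewrite -?EFinB ltry.
Qed.

Lemma continuous_Rint_trig (R : realType) (Omega : set R) (g : R -> R) :
  domain1d Omega -> continuous g -> (forall x, `|g x| <= 1) ->
  continuous (fun xi : R => (\int[lebesgue_measure]_(x in Omega) g (xi * x))%R).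
Proof.
move=> dO cg g1 a.
have mO : measurable Omega by case: dO => _ _; exact: open_measurable.
have fO := domain1d_finite_measure dO.
have cgl (xi : R) : continuous (fun x : R => g (xi * x)).
  by move=> x; apply: continuous_comp; [exact: mulrl_continuous|exact: cg].
have cgr (x : R) : continuous (fun xi : R => g (xi * x)).
  by move=> xi; apply: continuous_comp; [exact: mulrr_continuous|exact: cg].
apply: (@continuity_under_integral R _ _ lebesgue_measure
  (fun xi x => g (xi * x)) Omega mO (a - 1) (a + 1) _ _ (cst 1)).
- move=> xi _; apply: measurable_bounded_integrable => //.
    by apply: measurable_funTS; exact: continuous_measurable_fun.
  by exists 1; split => // M M1 x _; exact: le_trans (g1 _) (ltW M1).
- by apply: aeW => x _ xi _; exact: cgr.
- apply: measurable_bounded_integrable => //.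
  by exists 1; split => // M M1 x _; rewrite /cst normr1 ltW.
- by move=> xi _; apply: aeW => x _; exact: g1.
- by rewrite inE/= in_itv/= ltrDl ltrBlDr ltrDl ltr01.
Qed.

Lemma closed_fourier_zeros (R : realType) (Omega : set R) :
  domain1d Omega -> closed (fourier_zeros Omega).
Proof.
move=> dO.
pose c (xi : R) := (\int[lebesgue_measure]_(x in Omega) cos (xi * x))%R.
pose s (xi : R) := (\int[lebesgue_measure]_(x in Omega) sin (xi * x))%R.
have -> : fourier_zeros Omega = c @^-1` [set 0] `&` s @^-1` [set 0].
  apply/seteqP; split => xi; first by case.
  by rewrite /fourier_zeros /fourier_indic /cintegral/= -/(c xi) -/(s xi) => -[-> ->].
have cl0 : closed [set (0 : R)] by exact: closed_eq.
apply: closedI; apply: closed_comp => // x _.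
  apply: continuous_Rint_trig => //; first exact: continuous_cos.
  by move=> y; rewrite ler_norml cos_geN1 cos_le1.
apply: continuous_Rint_trig => //; first exact: continuous_sin.
by move=> y; rewrite ler_norml sin_geN1 sin_le1.
Qed.

Lemma kappa_attained (R : realType) (Omega : set R) :
  domain1d Omega -> fourier_zeros Omega !=set0 ->
  exists2 xi, fourier_zeros Omega xi & kappa Omega = `|xi|%:E.
Proof.
move=> dO [z0 Nz0].
pose K := fourier_zeros Omega `&` `[- `|z0|, `|z0|].
have cK : compact K.
  rewrite /K setIC; apply: compact_closedI; last exact: closed_fourier_zeros.
  exact: segment_compact.
have Kz0 : K !=set0.
  by exists z0; split => //; rewrite /= in_itv/= -ler_norml.
have cn : {within K, continuous (fun x : R => `|x|)}.
  by apply: continuous_subspaceT => x; exact: norm_continuous.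
have [xi] := compact_EVT_min Kz0 cK cn.
rewrite inE => -[Nxi xiz0] xi_min; exists xi => //.
apply/eqP; rewrite eq_le; apply/andP; split.
  by apply: ereal_inf_lbound; exists xi.
apply: le_ereal_inf_tmp => _ [z Nz <-]; rewrite lee_fin.
have [zz0|/ltW z0z] := leP `|z| `|z0|.
  by apply: xi_min; rewrite inE; split => //; rewrite /= in_itv/= -ler_norml.
apply: le_trans z0z.
by move: xiz0; rewrite /= in_itv/= -ler_norml.
Qed.

Lemma kappa_no_zeros (R : realType) (Omega : set R) :
  fourier_zeros Omega = set0 -> kappa Omega = +oo%E.
Proof. by rewrite /kappa => ->; rewrite image_set0 ereal_inf0. Qed.

(* Main.v *)
Require Import Defs.
From mathcomp Require Import all_boot all_order all_algebra.
From mathcomp Require Import complex lra ring.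
From mathcomp Require Import all_classical all_reals all_analysis.
From mathcomp Require Import measurable_realfun.

(* Let Omega be the union, over |k| <= n, of the intervals of length r^|k|
   centred at the integers k, with r = 1 - q close to 1 and n so large that
   r^n is negligible: at the scale 1/q it imitates the density e^{-|x|}, whose
   Fourier transform has no zero.  Replacing cos (xi x) by its value at the
   centre of each interval, its transform at xi is the Poisson kernel
   (1 - r^2) / (1 - 2 r cos xi + r^2) up to an error |xi| |Omega| / 2.  For
   |xi| <= A q the kernel is of order 1 / (q (1 + A^2)) while the error is at
   most A, so kappa(Omega) >= A q once q is small with respect to A.  As
   |Omega| is about 2/q, kappa of the centred interval, namely 2 pi / |Omega|,
   is of order q, while A is arbitrary. *)

Set Implicit Arguments.
Unset Strict Implicit.
Unset Printing Implicit Defensive.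

Import Order.TTheory GRing.Theory Num.Theory.
Import numFieldNormedType.Exports.

Local Open Scope classical_set_scope.
Local Open Scope ring_scope.

(** * Trigonometric estimates and the truncated Poisson kernel *)

Lemma exists_exprS_lt (R : realType) (x e : R) : `|x| < 1 -> 0 < e ->
  exists n, x ^+ n.+1 < e.
Proof.
move=> /cvg_expr/cvgr0Pnorm_lt + e0 => /(_ e e0)[n _ /(_ n.+1 (leqnSn n)) h].
by exists n; apply: le_lt_trans h; exact: ler_norm.
Qed.

Lemma ler_norm_sin (R : realType) (x : R) : `|sin x| <= `|x|.
Proof.
wlog x0 : x / 0 <= x => [hw|].
  by have [/hw//|/ltW x0] := leP 0 x; rewrite -normrN -sinN -(normrN x) hw ?oppr_ge0.
have [y _] : exists2 c : R, c \in `[0, x] & sin x - sin 0 = cos c * (x - 0).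
  apply: MVT_segment => //.
  exact/continuous_subspaceT/continuous_sin.
rewrite sin0 !subr0 => ->.
by rewrite normrM ler_piMl// cos_max.
Qed.

Lemma cos_lipschitz (R : realType) (x y : R) : `|cos x - cos y| <= `|x - y|.
Proof.
pose u := (x + y) / 2; pose v := (x - y) / 2.
have -> : x = u + v by rewrite /u /v; lra.
have -> : y = u - v by rewrite /u /v; lra.
move: u v => u v.
have -> : cos (u + v) - cos (u - v) = - (2 * (sin u * sin v)).
  by rewrite cosD cosB; ring.
have -> : u + v - (u - v) = 2 * v by ring.
rewrite normrN !normrM ler_wpM2l//.
apply: le_trans (ler_norm_sin v).
by rewrite ler_piMl// sin_max.
Qed.

(** Half-angle formula [cos x = 1 - 2 sin(x/2)^2] together with [|sin y| <= |y|]. It bounds the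
    denominator of the Poisson kernel from above. *)
Lemma cos_ge_quadratic (R : realType) (x : R) : 1 - x ^+ 2 / 2 <= cos x.
Proof.
have -> : x = (x / 2) *+ 2 by lra.
rewrite cos_mulr2n cos2sin2.
have : sin (x / 2) ^+ 2 <= (x / 2) ^+ 2.
  rewrite -(real_normK (num_real (sin _))) -(real_normK (num_real (x / 2))).
  by rewrite lerXn2r ?nnegrE// ler_norm_sin.
nra.
Qed.

(* [\sum_(|k| <= n) r ^ |k| e^{ikt}], a truncated Poisson kernel *)
Definition cos_sum (R : realType) (r t : R) (n : nat) : R :=
  1 + 2 * \sum_(k < n) r ^+ k.+1 * cos (t * k.+1%:R).

Lemma cos_sumS (R : realType) (r t : R) (n : nat) :
  cos_sum r t n.+1 = cos_sum r t n + 2 * r ^+ n.+1 * cos (t * n.+1%:R).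
Proof. by rewrite /cos_sum big_ord_recr/=; ring. Qed.

(** The factor is [|1 - r e^{it}|^2]; multiplying by it telescopes the sum, by the three-term
    recurrence of [cos (t k)], and leaves only [1 - r^2] and two truncation terms. *)
Lemma cos_sumE (R : realType) (r t : R) (n : nat) :
  (1 - 2 * r * cos t + r ^+ 2) * cos_sum r t n =
  1 - r ^+ 2 - 2 * r ^+ n.+1 * cos (t * n.+1%:R)
  + 2 * r ^+ n.+2 * cos (t * n%:R).
Proof.
rewrite /cos_sum; elim: n => [|n IHn].
  by rewrite big_ord0 !mulr0 mulr1 cos0 expr1; ring.
have cosS : cos (t * n.+2%:R) = 2 * cos t * cos (t * n.+1%:R) - cos (t * n%:R).
  have -> : t * n.+2%:R = t * n.+1%:R + t by rewrite -natr1; ring.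
  have -> : t * n%:R = t * n.+1%:R - t by rewrite -natr1; ring.
  by rewrite cosD cosB; ring.
rewrite big_ord_recr/= [2 * (_ + _)]mulrDr addrA mulrDr IHn cosS !exprS; ring.
Qed.

(** * The comb of intervals *)

Fixpoint comb (R : realType) (r : R) (n : nat) : set R :=
  if n is m.+1 then
    comb r m `|`
    (ball (m.+1%:R : R) (r ^+ m.+1 / 2) `|` ball (- m.+1%:R : R) (r ^+ m.+1 / 2))
  else ball (0 : R) (1 / 2).

Section comb.
Context {R : realType} (r : R) (r01 : 0 < r <= 1).

Let w_le n : r ^+ n / 2 <= 1 / 2.
Proof.
by case/andP: r01 => /ltW r0 r1; rewrite ler_pM2r ?invr_gt0// exprn_ile1.
Qed.

Lemma comb_open n : open (comb r n).
Proof.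
elim: n => [|n IHn] /=; first exact: ball_open.
by apply: openU => //; apply: openU; exact: ball_open.
Qed.

Lemma comb_measurable n : measurable (comb r n).
Proof. by apply: open_measurable; exact: comb_open. Qed.

(** Sharp enough to separate [comb r n] from the next two balls: their radius is at most 1/2, so
    their points satisfy [|x| > n + 1/2]. *)
Lemma comb_bounded n x : comb r n x -> `|x| < n%:R + 1 / 2.
Proof.
elim: n => [|n IHn] /=; first by rewrite /ball/= sub0r normrN add0r.
move=> [/IHn|]; first by rewrite -natr1; lra.
have n0 := ler0n R n; have := w_le n.+1; move: (r ^+ _ / 2) => w w1.
by rewrite /ball/= -natr1 !ltr_norml => -[] /andP[? ?]; apply/andP; split; lra.
Qed.

Lemma combN n x : comb r n x -> comb r n (- x).
Proof.
have ballN (c w : R) : ball c w x -> ball (- c) w (- x).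
  by rewrite /ball/= -opprD normrN.
elim: n => [|n IHn] /=; first by move/ballN; rewrite oppr0.
move=> [/IHn|[/ballN|/ballN]]; rewrite ?opprK.
- by left.
- by right; right.
- by right; left.
Qed.

Lemma comb_domain1d n : domain1d (comb r n).
Proof.
split; last exact: comb_open.
  exists 0; elim: n => [|n IHn] /=; last by left.
  by rewrite /ball/= subrr normr0; lra.
exists (n%:R + 1 / 2); split; first exact: num_real.
by move=> M nM x /comb_bounded/ltW/le_trans; apply; exact: ltW.
Qed.

Lemma comb_balanced n : balanced (comb r n).
Proof.
apply/seteqP; split => [_ [x /combN nx <-]//|x nx].
by exists (- x); rewrite ?opprK//; exact: combN.
Qed.

End comb.

(** * Cosine integrals and bounds on [kappa] *)

Section cos_integral.
Context {R : realType}.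
Local Notation mu := (@lebesgue_measure R).
Implicit Types (xi c w : R) (A : set R).

Lemma cosM_integrable xi A : domain1d A ->
  mu.-integrable A (EFin \o (fun x : R => cos (xi * x))).
Proof.
move=> dA; have [_ _ oA] := dA.
apply: measurable_bounded_integrable.
- exact: open_measurable.
- exact: domain1d_finite_measure.
- apply: measurable_funTS; apply: continuous_measurable_fun => x.
  by apply: continuous_comp; [exact: mulrl_continuous|exact: continuous_cos].
- by exists 1; split => // M M1 x _; exact: le_trans (cos_max _) (ltW M1).
Qed.

Lemma ball_domain1d c w : 0 < w -> domain1d (ball c w).
Proof.
move=> w0; split; [by exists c; exact: ballxx| |exact: ball_open].
exists (`|c| + w); split => [|M wM x]; first exact: num_real.
rewrite /ball/= => cwx; apply/ltW; apply: le_lt_trans wM.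
by rewrite -[x](subKr c) (le_trans (ler_normB _ _))// lerD2l ltW.
Qed.

(** On the ball, [xi * x] stays within [|xi| * w] of [xi * c], and [cos] is 1-Lipschitz; the factor
    [w * 2] is the length. *)
Lemma Rintegral_cos_ball xi c w : 0 < w ->
  w * 2 * (cos (xi * c) - `|xi| * w) <= \int[mu]_(x in ball c w) cos (xi * x).
Proof.
move=> w0; have dB := ball_domain1d c w0.
have mB : measurable (ball c w) by exact: measurable_ball.
rewrite mulrC -[w * 2](_ : fine (mu (ball c w)) = _); last first.
  by rewrite lebesgue_measure_ball ?ltW//= mulr_natr.
rewrite -Rintegral_cst//; apply: le_Rintegral => //.
- by apply: measurable_bounded_integrable => //;
    [exact: domain1d_finite_measure|exact: bounded_cst].
- exact: cosM_integrable.
move=> x cwx; rewrite lerBlDr -lerBlDl.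
apply: le_trans (ler_norm _) _; apply: le_trans (cos_lipschitz _ _) _.
by rewrite -mulrBr normrM ler_wpM2l// ltW.
Qed.

(** A zero of the transform is in particular a zero of its real part, the cosine integral. Without
    zeros the infimum is [+oo]. *)
Lemma kappa_ge A (X : R) : domain1d A ->
  (forall xi, `|xi| < X -> \int[mu]_(x in A) cos (xi * x) != 0) ->
  (X%:E <= kappa A)%E.
Proof.
move=> dA nz; apply: le_ereal_inf_tmp => _ [xi xi0 <-]; rewrite lee_fin leNgt.
apply/negP => /nz/eqP; apply; exact: (congr1 (@complex.Re R) xi0).
Qed.

(** The frequency [2 pi / l] is a zero: the antiderivatives [sin (xi x) / xi] and
    [- cos (xi x) / xi] agree at both endpoints, where [xi x] is [pi] or [- pi]. *)
Lemma kappa_centred_itv_le A : (0 < fine (mu A)) ->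
  (kappa (centred_itv A) <= (2 * pi / fine (mu A))%:E)%E.
Proof.
rewrite /centred_itv; set l := fine _ => l0.
apply: ereal_inf_lbound; exists (2 * pi / l); last first.
  by rewrite ger0_norm// divr_ge0 ?mulr_ge0 ?pi_ge0// ltW.
set xi := 2 * pi / l.
have xi0 : xi != 0 by rewrite !mulf_neq0 ?invr_eq0 ?gt_eqF ?pi_gt0.
have xil : xi * (l / 2) = pi by rewrite /xi; field; rewrite gt_eqF.
have ll : - (l / 2) < l / 2 by lra.
have FTC (f F : R -> R) : continuous f -> (forall x : R, is_derive x 1 F (f x)) ->
    \int[mu]_(x in `](- (l / 2)), (l / 2)[) f x = F (l / 2) - F (- (l / 2)).
  move=> cf dF.
  have cF : continuous F.
    by move=> x; apply/differentiable_continuous/derivable1_diffP; exact: ex_derive.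
  have fint : mu.-integrable `[(- (l / 2)), (l / 2)] (EFin \o f).
    apply: continuous_compact_integrable; first exact: segment_compact.
    exact: continuous_subspaceT.
  rewrite Rintegral_itv_bndo_bndc; last first.
    by apply: integrableS fint => //; apply: subset_itv; rewrite bnd_simp.
  rewrite Rintegral_itv_obnd_cbnd; last first.
    by apply: integrableS fint => //; apply: subset_itv; rewrite bnd_simp.
  rewrite /Rintegral (@continuous_FTC2 _ f F)//.
  - exact: continuous_subspaceT.
  - split => [x _| |]; first exact: ex_derive.
      exact/cvg_at_right_filter/cF.
    exact/cvg_at_left_filter/cF.
  - by move=> x _; rewrite derive1E; exact: derive_val.
have cM (g : R -> R) : continuous g -> continuous (fun x => g (xi * x)).
  by move=> cg x; apply: continuous_comp; [exact: mulrl_continuous|exact: cg].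
congr (_ +i* _)%C.
  have dS (x : R) : is_derive x 1 (fun x => sin (xi * x) / xi) (cos (xi * x)).
    by apply: is_derive_eq; rewrite /GRing.scale/= mulr1; field.
  rewrite (FTC _ _ _ dS); last exact/cM/continuous_cos.
  by rewrite mulrN xil sinN sinpi; ring.
have dC (x : R) : is_derive x 1 (fun x => - cos (xi * x) / xi) (sin (xi * x)).
  by apply: is_derive_eq; rewrite /GRing.scale/= mulr1; field.
rewrite (FTC _ _ _ dC); last exact/cM/continuous_sin.
by rewrite mulrN xil cosN; ring.
Qed.

End cos_integral.

(** * Transform and length of the comb *)

Section comb_fourier.
Context {R : realType} (r : R) (r01 : 0 < r <= 1).
Local Notation mu := (@lebesgue_measure R).

(** Adds up [Rintegral_cos_ball] over the disjoint intervals; [cos_sum r 0 n] is their total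
    length. *)
Lemma comb_fourier_ge (xi : R) n :
  cos_sum r xi n - `|xi| / 2 * cos_sum r 0 n <=
  \int[mu]_(x in comb r n) cos (xi * x).
Proof.
elim: n => [|n IHn].
  rewrite /cos_sum !big_ord0; have /(Rintegral_cos_ball xi 0) : 0 < 1 / 2 :> R by lra.
  rewrite mulr0 cos0 /=; lra.
have w0 : 0 < r ^+ n.+1 / 2 by case/andP: r01 => r0 _; rewrite divr_gt0 ?exprn_gt0.
have w1 : r ^+ n.+1 <= 1 by case/andP: r01 => /ltW r0 r1; rewrite exprn_ile1.
rewrite !cos_sumS mul0r cos0.
have := comb_domain1d r01 n.+1; rewrite /=.
move: (comb_bounded r01 (n := n)) IHn (comb_measurable r n).
move: (comb r n) => A Ab IHn mA dAB.
have iAB := cosM_integrable xi dAB.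
have mB : measurable (ball (n.+1%:R : R) (r ^+ n.+1 / 2)
                     `|` ball (- n.+1%:R : R) (r ^+ n.+1 / 2)).
  by apply: measurableU; exact: measurable_ball.
rewrite Rintegral_setU//; last first.
  apply/disj_setPS => x [/= /Ab]; have := ler0n R n.
  rewrite /ball/= -(natr1 n) !ltr_norml => n0 /andP[? ?] [] /andP[? ?]; lra.
rewrite Rintegral_setU; last first.
- apply/disj_setPS => x [/=]; have := ler0n R n.
  rewrite /ball/= -(natr1 n) !ltr_norml => n0 /andP[? ?] /andP[? ?]; lra.
- by apply: integrableS iAB => //; exact: measurableU.
- exact: measurable_ball.
- exact: measurable_ball.
have := Rintegral_cos_ball xi n.+1%:R w0.
have := Rintegral_cos_ball xi (- n.+1%:R) w0.
rewrite mulrN cosN; have := normr_ge0 xi.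
move: (r ^+ n.+1) w0 w1 `|xi| IHn => w w0 w1 t IHn t0.
(* The two new balls cost an error [|xi| w^2], with [w = r^(n+1) <= 1]; it is weakened to be linear
   in the length. *)
have : t * w * w <= t * w by rewrite ler_piMr// mulr_ge0//; lra.
lra.
Qed.

(** The case [xi = 0] of the previous bound: the integrand is 1 and the error vanishes. *)
Lemma comb_measure_ge n : cos_sum r 0 n <= fine (mu (comb r n)).
Proof.
have := comb_fourier_ge 0 n.
rewrite normr0 !mul0r subr0 -[fine _]mul1r -Rintegral_cst; last exact: comb_measurable.
by under eq_Rintegral do rewrite mul0r cos0.
Qed.

End comb_fourier.

(** * Choice of parameters and contradiction *)

Theorem theorem2p9 (R : realType) :
  ~ (exists C : R, forall Omega : set R,
       domain1d Omega -> balanced Omega ->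
       (kappa Omega <= C%:E * kappa (centred_itv Omega))%E).
Proof.
case=> C kappaC.
(* The two bounds will be [A q <= kappa Omega] and [kappa (centred_itv Omega) <= 8 q], so
   [A > 8 |C|] contradicts [kappaC]. *)
pose A := 8 * `|C| + 1; have A1 : 1 <= A by rewrite lerDr mulr_ge0.
pose D := 1 + A ^+ 2; have D1 : 1 <= D by rewrite lerDl sqr_ge0.
have AD1 : 1 <= A * D by rewrite -[leLHS]mulr1 ler_pM.
(* For [|xi| < A q] the kernel is at least [1 / (q D)], which this choice makes equal to [4 A]; the
   error is at most [A]. *)
pose q := (4 * (A * D))^-1.
have qE : q * (4 * (A * D)) = 1 by rewrite mulVf// gt_eqF//; lra.
have q0 : 0 < q by rewrite invr_gt0; lra.
have q4 : q <= 1 / 4 by nra.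
pose r := 1 - q; have r01 : 0 < r <= 1 by rewrite /r; apply/andP; split; lra.
have [||n rn] := @exists_exprS_lt _ r (q / 8); [|lra|].
  by rewrite /r ltr_norml; apply/andP; split; lra.
have rn0 : 0 < r ^+ n.+1 by rewrite exprn_gt0//; case/andP: r01.
(* At [t = 0] the factor in [cos_sumE] is [(1 - r)^2 = q^2]; one [q] cancels. *)
have S0 : q * cos_sum r 0 n = 2 - q - 2 * r ^+ n.+1.
  have := cos_sumE r 0 n; rewrite !mul0r cos0 !mulr1 (exprS _ n.+1) => h.
  apply: (mulfI (lt0r_neq0 q0)); rewrite mulrA.
  have -> : q * q = 1 - 2 * r + r ^+ 2 by rewrite /r; ring.
  by rewrite h; move: (r ^+ n.+1) => rn'; rewrite /r; ring.
have S0_gt0 : 1 <= q * cos_sum r 0 n by rewrite S0; lra.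
pose Omega := comb r n.
have dO : domain1d Omega := comb_domain1d r01 n.
have muO : q^-1 <= fine (lebesgue_measure Omega).
  apply: le_trans (comb_measure_ge r01 n).
  by rewrite -(ler_pM2l q0) divff ?gt_eqF.
have kO : ((A * q)%:E <= kappa Omega)%E.
  apply: kappa_ge => // xi xiAq; rewrite gt_eqF//.
  apply: lt_le_trans (comb_fourier_ge r01 xi n).
  have S_ge : 1 <= q * D * cos_sum r xi n.
    (* [T = q^2 + 2 r (1 - cos xi)] lies between [q^2] and [q^2 + xi^2 <= q^2 D]. *)
    pose T := 1 - 2 * r * cos xi + r ^+ 2.
    have xi2 : xi ^+ 2 <= A ^+ 2 * q ^+ 2.
      have Aq0 : 0 < A * q by rewrite mulr_gt0//; lra.
      by rewrite -exprMn -(real_normK (num_real xi)) lerXn2r ?nnegrE// ltW.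
    have T_ge : q ^+ 2 <= T by have := cos_le1 xi; rewrite /T /r; nra.
    have T_le : T <= q * (q * D).
      by have := cos_ge_quadratic xi; rewrite /T /D /r; nra.
    (* Here [1 - r^2 = 2 q - q^2], and the truncation terms are at least [- 4 r^(n+1) > - q / 2]. *)
    have TS : q <= T * cos_sum r xi n.
      rewrite cos_sumE (exprS _ n.+1).
      have := cos_le1 (xi * n.+1%:R); have := cos_geN1 (xi * n%:R).
      move: (r ^+ n.+1) rn rn0 (cos (xi * n%:R)) (cos (xi * n.+1%:R)).
      move=> s sq s0 c' c c'N1 c1; have [r0 r1] := andP r01.
      have rs0 : 0 < r * s by rewrite mulr_gt0.
      have sc : s * c <= s by rewrite ler_piMr// ltW.
      have : - (r * s) <= r * s * c' by rewrite -mulrN1 ler_pM2l.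
      have : r * s <= s by rewrite ler_piMl// ltW.
      rewrite /r; nra.
    have T_gt0 : 0 < T by apply: lt_le_trans T_ge; rewrite exprn_gt0.
    have S_gt0 : 0 < cos_sum r xi n by rewrite -(pmulr_rgt0 _ T_gt0) (lt_le_trans q0).
    rewrite -(ler_pM2l q0) mulr1 (le_trans TS)// !mulrA ler_pM2r//.
    by rewrite -mulrA.
  have S_ge4A : 4 * A <= cos_sum r xi n.
    have qD0 : 0 < q * D by rewrite mulr_gt0//; lra.
    rewrite -(ler_pM2l qD0) (_ : q * D * (4 * A) = 1)// -[RHS]qE; ring.
  have : `|xi| * cos_sum r 0 n <= A * (q * cos_sum r 0 n).
    have S0_pos : 0 < cos_sum r 0 n by rewrite -(pmulr_rgt0 _ q0) (lt_le_trans ltr01).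
    by rewrite mulrA ler_pM2r// ltW.
  have : A * (q * cos_sum r 0 n) <= A * 2 by rewrite ler_pM2l ?S0; lra.
  lra.
have kO' : (kappa (centred_itv Omega) <= (8 * q)%:E)%E.
  have muO0 : 0 < fine (lebesgue_measure Omega).
    by apply: lt_le_trans muO; rewrite invr_gt0.
  apply: (le_trans (kappa_centred_itv_le muO0)); rewrite lee_fin ler_pdivrMr//.
  have pi4 : pi < 4 :> R by have := pihalf_lt2 R; lra.
  have : 1 <= q * fine (lebesgue_measure Omega) by rewrite -ler_pdivrMl// mulr1.
  lra.
have := kappaC Omega dO (comb_balanced r n).
rewrite leNgt => /negP; apply.
apply: lt_le_trans kO.
(* [C] may be negative; passing to [|C|] uses [kappa >= 0] and makes the product monotone in
   [kappa]. *)
apply: le_lt_trans (_ : (`|C| * (8 * q))%:E < _)%E; last first.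
  by rewrite lte_fin mulrA ltr_pM2r// /A; lra.
rewrite EFinM; apply: (@le_trans _ _ (`|C|%:E * kappa (centred_itv Omega))%E).
  rewrite lee_wpmul2r// ?lee_fin ?ler_norm//.
  by apply: le_ereal_inf_tmp => _ [x _ <-]; rewrite lee_fin.
by rewrite lee_wpmul2l ?lee_fin.
Qed.
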